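(* Let $d,e$ be integers with $1\le e\le \frac d2$ and let $F$ be a nonzero binary form of degree $d$ over $\mathbb C$ in the variables $x_0,x_1$. Let $\mathfrak D(F)$ and $\mathfrak C_e(F)$ be the polynomial covariants of $F$ defined in the context. Then $F=L_1^{d-e}L_2^{e}$ for some linear forms $L_1,L_2$ if and only if $\mathfrak C_e(F)=\mathfrak D(F)=0$ identically.
   Context: Subscripts on forms denote partial derivatives, e.g. $F_{x_0^\mu x_1^\nu}=\partial^{\mu+\nu}F/\partial x_0^\mu\partial x_1^\nu$. $\mathfrak D(F)$ is the determinant of the $4\times4$ matrix whose rows are indexed by $G\in(x_0F_{x_0},\,x_0F_{x_1},\,x_1F_{x_0},\,x_1F_{x_1})$, the row of $G$ being $(G_{x_0^3},\,G_{x_0^2x_1},\,G_{x_0x_1^2},\,G_{x_1^3})$. The Hessian of $A(x_0,x_1)$ is $\mathrm{He}(A)=A_{x_0^2}A_{x_1^2}-(A_{x_0x_1})^2$. For binary forms $A,B$ of degrees $m,n$ and $0\le k\le\min\{m,n\}$ the $k$-th transvectant is $$(A,B)_k=\frac{(m-k)!\,(n-k)!}{m!\,n!}\sum_{i=0}^k(-1)^i\binom ki\frac{\partial^kA}{\partial x_0^{k-i}\partial x_1^i}\frac{\partial^kB}{\partial x_0^i\partial x_1^{k-i}},$$ and it is taken to be $0$ if $k>\min\{m,n\}$. For binary forms $P,Q$ of degrees $p,q\ge0$ put $$J(P,Q)=z_1\,Q^2(P,P)_2+z_2\,P^2(Q,Q)_2+z_3\,(P^2,Q^2)_2,$$ $$z_1=\frac{p^2(p-1)(2p-2q-1)(p-q-1)}{2(2p-1)},\quad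 z_2=-\frac{q^2(q-1)(2p-2q+1)(p-q-1)}{2(2q-1)},\quad z_3=pq(p-q-1).$$ Finally $\mathfrak C_e(F)=J\big(F^{2d-2e-2},\,\mathrm{He}(F)^{d-e}\big)$, where $J$ is formed with $p=d(2d-2e-2)$ and $q=(2d-4)(d-e)$. *)

(* Defs.v *)
From mathcomp Require Import all_boot all_order all_algebra.
From mathcomp Require Import reals.
From mathcomp.real_closed Require Import complex.
From mathcomp.multinomials Require Import mpoly.

Set Implicit Arguments.
Unset Strict Implicit.
Unset Printing Implicit Defensive.

Import GRing.Theory Num.Theory.
Local Open Scope ring_scope.

Definition x0 : 'I_2 := ord0.
Definition x1 : 'I_2 := ord_max.

(* Binary forms of degree d over K are the elements of {mpoly K[2]} that
   satisfy \is d.-homog; this includes the zero polynomial for every d. *)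

Section Covariants.

Variable K : numFieldType.
Implicit Types A B F P Q : {mpoly K[2]}.

Definition dpart (mu nu : nat) A : {mpoly K[2]} := (A^`M(x0, mu))^`M(x1, nu).

Definition Dcov F : {mpoly K[2]} :=
  let rows := [tuple 'X_x0 * F^`M(x0); 'X_x0 * F^`M(x1);
                     'X_x1 * F^`M(x0); 'X_x1 * F^`M(x1)] in
  \det (\matrix_(i < 4, j < 4) dpart (3 - j) j (tnth rows i)).

Definition hessian A : {mpoly K[2]} :=
  dpart 2 0 A * dpart 0 2 A - dpart 1 1 A ^+ 2.

(* The formal degrees m of A and n of B are explicit arguments, as they cannot
   be recovered from A and B when these vanish. *)
Definition transvectant (m n k : nat) A B : {mpoly K[2]} :=
  if (k <= minn m n)%N then
    (((m - k)`! * (n - k)`!)%:R / (m`! * n`!)%:R : K) *: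
      \sum_(i < k.+1) (-1) ^+ i * 'C(k, i)%:R *
        dpart (k - i) i A * dpart i (k - i) B
  else 0.

Definition z1 (p q : nat) : K :=
  (p%:R ^+ 2 * (p%:R - 1) * (2 * p%:R - 2 * q%:R - 1) * (p%:R - q%:R - 1))
  / (2 * (2 * p%:R - 1)).

Definition z2 (p q : nat) : K :=
  - ((q%:R ^+ 2 * (q%:R - 1) * (2 * p%:R - 2 * q%:R + 1) * (p%:R - q%:R - 1))
     / (2 * (2 * q%:R - 1))).

Definition z3 (p q : nat) : K := p%:R * q%:R * (p%:R - q%:R - 1).

Definition Jcov (p q : nat) P Q : {mpoly K[2]} :=
  z1 p q *: (Q ^+ 2 * transvectant p p 2 P P)
  + z2 p q *: (P ^+ 2 * transvectant q q 2 Q Q)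
  + z3 p q *: transvectant (2 * p) (2 * q) 2 (P ^+ 2) (Q ^+ 2).

(* The truncated subtractions are exact when 1 <= e and 2 * e <= d. *)
Definition Ccov (d e : nat) F : {mpoly K[2]} :=
  Jcov (d * (2 * d - 2 * e - 2)) ((2 * d - 4) * (d - e))
    (F ^+ (2 * d - 2 * e - 2)) (hessian F ^+ (d - e)).

End Covariants.

(* Main.v *)
(* Vanishing of D(F) is, by Euler's relation, vanishing of a Wronskian of the
   four forms x_i F_(x_j), hence it means that they are linearly dependent:
   some derivation l0 d/dx0 + l1 d/dx1 with linear coefficients, not both zero,
   kills F. Such a derivation maps every linear factor of F to a multiple of
   itself, so every root of F is a root of the nonzero quadratic form
   x0 l1 - x1 l0; thus F = L1^a L2^b with a + b = d. For such an F, both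
   F^(2d-2e-2) and He(F)^(d-e) are, up to scalars, products of powers of L1 and
   L2, say with exponents (al, be) and (ga, de), and then J(P, Q) equals
   -(p-q-1) (al-ga) (be-de) det(L1, L2)^2 P^2 Q^2 / (L1 L2)^2.
   Here p - q = 2(d-2e) is even, al - ga = 2(d-e-a) and be - de = 2(d-e-b). *)
Require Import Defs.
From mathcomp Require Import all_boot all_order all_algebra.
From mathcomp Require Import reals.
From mathcomp.real_closed Require Import complex.
From mathcomp.multinomials Require Import mpoly.
From mathcomp Require Import zify ring.

Set Implicit Arguments.
Unset Strict Implicit.
Unset Printing Implicit Defensive.

Import Order.TTheory GRing.Theory Num.Theory.
Local Open Scope ring_scope.

(** * Derivations and Wronskians *)

Lemma mdegS_split n (m : 'X_{1..n}) k :
  mdeg m = k.+1 -> exists i m', m = (m' + U_(i))%MM /\ mdeg m' = k.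
Proof.
move=> degm; have [i mi] : exists i, (0 < m i)%N.
  have : mdeg m != 0%N by rewrite degm.
  rewrite mdegE sum_nat_eq0 => /forallPn[i /= mi].
  by exists i; rewrite lt0n.
have le_m : (U_(i) <= m)%MM.
  by apply/mnm_lepP => j; rewrite mnm1E; case: eqP => // <-.
exists i, (m - U_(i))%MM; rewrite submK //; split=> //.
by apply/eqP; rewrite -eqSS -degm -{2}(submK le_m) mdegD mdeg1 addn1.
Qed.

Section Derivations.

Variables (K : numFieldType) (n : nat).
Implicit Types (p q : {mpoly K[n]}) (m : 'X_{1..n}).

(** The factor ['X_i] makes the derivation diagonal on monomials, so coefficients are compared
    without an index shift. *)
Lemma mcoeff_mulX_mderiv i p m : ('X_i * p^`M(i))@_m = p@_m *+ m i.
Proof.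
rewrite mulrC; have [mi0|mi_gt0] := posnP (m i).
  rewrite mi0 mulr0n mcoeffM big1 // => -[m1 m2] /= /eqP m12.
  rewrite mcoeffX; case: eqP => [U2|_]; last by rewrite mulr0.
  move/(congr1 (fun m : 'X_{1..n} => m i)): m12.
  by rewrite mi0 -U2 mnmDE mnm1E eqxx addn1.
have le_m : (U_(i) <= m)%MM.
  by apply/mnm_lepP => j; rewrite mnm1E; case: eqP => // <-.
rewrite -{1}(submK le_m) addmC mcoeffMX mcoeff_mderiv submK //.
by rewrite mnmBE mnm1E eqxx subn1 prednK.
Qed.

Lemma dhomog_mderiv d i p : p \is d.-homog -> p^`M(i) \is d.-1.-homog.
Proof.
move=> /dhomogP hp; apply/dhomogP => m; rewrite mcoeff_msupp mcoeff_mderiv.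
rewrite -mulr_natr mulf_eq0 negb_or => /andP[hm _].
by rewrite -(hp (m + U_(i))%MM) ?mcoeff_msupp //= mdegD mdeg1 addn1.
Qed.

Lemma dhomog_mderivm d m p : p \is d.-homog -> p^`M[m] \is (d - mdeg m).-homog.
Proof.
move=> hp; move: {2}(mdeg m) (erefl (mdeg m)) => k.
elim: k m => [|k IHk] m degm.
  move/eqP: degm; rewrite mdeg_eq0 => /eqP ->.
  by rewrite mderivm0m mdeg0 subn0.
have [i [m' [mE degm']]] := mdegS_split degm.
rewrite {1}mE mderivmDm mderivmU1m degm subnS -degm'.
by apply/dhomog_mderiv/IHk.
Qed.

Lemma euler d p : p \is d.-homog -> \sum_i 'X_i * p^`M(i) = d%:R *: p.
Proof.
move=> hp; apply/mpolyP => m; rewrite raddf_sum mcoeffZ mulr_natl /=.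
under eq_bigr do rewrite mcoeff_mulX_mderiv.
rewrite sumrMnr -mdegE; have [->//|neq_m] := eqVneq (mdeg m) d.
by rewrite (dhomog_nemf_coeff hp neq_m) !mul0rn.
Qed.

(* Let r be p minus the multiple of q killing its coefficient at the leading
   monomial of q. If r were nonzero, comparing leading coefficients in
   q X_i dr/dX_i = r X_i dq/dX_i would give r and q the same leading monomial. *)
Lemma mderiv_proportional p q : q != 0 ->
  (forall i, q * p^`M(i) = p * q^`M(i)) -> exists c : K, p = c *: q.
Proof.
move=> q0 hpq; pose c := p@_(mlead q) / mleadc q; exists c.
have cq0 : mleadc q != 0 by rewrite mleadc_eq0.
apply/eqP; rewrite -subr_eq0; set r : {mpoly K[n]} := p - _.
have rq : r@_(mlead q) = 0 by rewrite mcoeffB mcoeffZ divfK ?subrr.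
have hr i : q * r^`M(i) = r * q^`M(i).
  rewrite mderivB mderivZ mulrBr hpq mulrBl; congr (_ - _).
  by rewrite -scalerAl -scalerAr.
(* Only a weak bound: the leading term of s is lost when ['X_i] does not occur in it. *)
have leXd (s : {mpoly K[n]}) i : (mlead ('X_i * s^`M(i)) <= mlead s)%O.
  have [->|t0] := eqVneq ('X_i * s^`M(i)) 0.
    by rewrite mlead0 le0x.
  move: (mlead_supp t0); move: (mlead _) => m.
  rewrite mcoeff_msupp mcoeff_mulX_mderiv.
  rewrite -mulr_natr mulf_eq0 negb_or -mcoeff_msupp => /andP[+ _].
  exact: msupp_le_mlead.
apply: contraT => r0; suff e : mlead r = mlead q.
  by move: r0; rewrite -mleadc_eq0 e rq eqxx.
apply/mnmP => i.
have := congr1 (fun s => ('X_i * s)@_(mlead q + mlead r)%MM) (hr i).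
rewrite /= mulrCA [X in _ = X@__ -> _]mulrCA mleadcMW // [X in _ = _@_X]addmC.
rewrite mleadcMW // !mcoeff_mulX_mderiv !mulrnAr [X in _ = X *+ _]mulrC.
by apply: mulrIn; rewrite mulf_neq0 ?mleadc_eq0.
Qed.

Section Wronskian.

Variables (I : finType) (d : nat) (G : I -> {mpoly K[n]}).
Hypothesis homG : forall i, G i \is d.-homog.

(** The row v lies in the left kernel of the matrix of all order-k partials of the [G i]. Lower
    orders are not imposed: for forms of degree d they follow when k <= d. *)
Definition wronskian_relation k (v : I -> {mpoly K[n]}) :=
  forall m, mdeg m = k -> \sum_i v i * (G i)^`M[m] = 0.

(** The order-k partials are forms of degree d - k, so Euler's relation writes d - k times each of
    them through partials of order k + 1; this factor is invertible because k < d. *)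
Lemma wronskian_relation_pred k v : (k < d)%N ->
  wronskian_relation k.+1 v -> wronskian_relation k v.
Proof.
move=> lt_kd hv m degm.
have dk0 : (d - k)%:R != 0 :> K by rewrite pnatr_eq0 subn_eq0 -ltnNge.
apply: (scalerI dk0); rewrite scaler0 scaler_sumr.
transitivity (\sum_j 'X_j * \sum_i v i * (G i)^`M[m + U_(j)]).
  under [RHS]eq_bigr do rewrite mulr_sumr; rewrite exchange_big /=.
  apply: eq_bigr => i _; have := euler (dhomog_mderivm m (homG i)).
  rewrite degm scalerAr => <-; rewrite mulr_sumr; apply: eq_bigr => j _.
  by rewrite mderivmDm mderivmU1m mulrCA.
by apply: big1 => j _; rewrite hv ?mulr0 // mdegD mdeg1 degm addn1.
Qed.

Lemma wronskian_relation_le k l v : (k <= d)%N -> (l <= k)%N ->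
  wronskian_relation k v -> wronskian_relation l v.
Proof.
move=> + le_lk; rewrite -(subnKC le_lk); elim: (k - l)%N => [|j IHj].
  by rewrite addn0.
rewrite addnS => lt_d /(wronskian_relation_pred lt_d).
by apply: IHj; apply: ltnW.
Qed.

(* Induction on the support of v: for i0 in it, the w j i below satisfy a
   relation of one order less and vanish at i = i0. If they all vanish, the
   quotients v i / v i0 are constants, giving the dependence. *)
Lemma linear_dependence_of_wronskian k (v : I -> {mpoly K[n]}) :
  (k <= d)%N -> (#|[pred i | v i != 0%R]| <= k.+1)%N ->
  (exists i, v i != 0) -> wronskian_relation k v ->
  exists2 c : I -> K, exists i, c i != 0 & \sum_i c i *: G i = 0.
Proof.
have [N] := ubnP k; elim: N k v => // N IHN k v lt_kN le_kd supp_v [i0 v0] rel_v.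
(* Up to sign, [w j i] is the j-th derivative of the quotient [v i / v i0], multiplied by
   [v i0 ^+ 2]. *)
pose w j i := (v i0)^`M(j) * v i - v i0 * (v i)^`M(j).
have card_w j : (#|[pred i | w j i != 0%R]| <= k)%N.
  move: supp_v; rewrite (cardD1 i0) [i0 \in _]v0 ltnS; apply: leq_trans.
  apply/subset_leq_card/subsetP => i; rewrite !inE => wi0.
  apply/andP; split; apply: contraNneq wi0; first by move->; rewrite /w mulrC subrr.
  by move=> vi; rewrite /w vi mderiv0 !mulr0 subrr.
have [/existsP[[j i] /= wji]|/existsPn w0] :=
  boolP [exists ji : 'I_n * I, w ji.1 ji.2 != 0].
- have k_gt0 : (0 < k)%N.
    by apply: leq_trans (card_w j); apply/card_gt0P; exists i.
  rewrite -(prednK k_gt0) in lt_kN le_kd rel_v card_w.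
  apply: (IHN k.-1 (w j) lt_kN (ltnW le_kd) (card_w j)); first by exists i.
  move=> m degm; rewrite /w; under eq_bigr do rewrite mulrBl -!mulrA.
  rewrite sumrB -!mulr_sumr.
  have rel_vm := wronskian_relation_pred le_kd rel_v degm.
  have := congr1 (mderiv j) rel_vm; rewrite raddf_sum mderiv0 /=.
  under eq_bigr => l _ do
    rewrite mderivM -[_^`M[m]^`M(j)]mderivmU1m -mderivmDm.
  rewrite big_split /= [X in _ + X]rel_v ?addr0; last first.
    by rewrite mdegD mdeg1 degm addn1.
  by rewrite rel_vm => ->; rewrite !mulr0 subrr.
have cP i : exists c : K, v i == c *: v i0.
  have [j|c ->] := @mderiv_proportional (v i) (v i0) v0; last by exists c.
  by apply/esym/eqP; rewrite -subr_eq0 mulrC; have := w0 (j, i); rewrite negbK.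
exists (fun i => xchoose (cP i)).
  exists i0; apply: contraNneq v0 => c0.
  by rewrite (eqP (xchooseP (cP i0))) c0 scale0r.
(* In order zero the relation is [v i0] times the desired linear combination, and [v i0] cancels. *)
have := wronskian_relation_le le_kd (leq0n _) rel_v
  (mdeg0 : mdeg (0%MM : 'X_{1..n}) = 0%N).
under eq_bigr => i _ do
  rewrite mderivm0m {1}(eqP (xchooseP (cP i))) -scalerAl scalerAr.
by rewrite -mulr_sumr => /eqP; rewrite mulf_eq0 (negPf v0) => /eqP.
Qed.

End Wronskian.

End Derivations.

(** * Binary forms and their roots *)

Lemma big_x0x1 (T : Type) (idx : T) (op : Monoid.law idx) (E : 'I_2 -> T) :
  \big[op/idx]_(i < 2) E i = op (E x0) (E x1).
Proof.
by rewrite big_ord_recr big_ord1; congr (op (E _) _); apply: val_inj.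
Qed.

Lemma ord2_cases (k : 'I_2) : k = x0 \/ k = x1.
Proof. by case: k => -[|[|//]] ?; [left|right]; apply: val_inj. Qed.

Lemma mderivXn (K : numFieldType) n i k (p : {mpoly K[n]}) :
  (p ^+ k.+1)^`M(i) = k.+1%:R * p ^+ k * p^`M(i).
Proof.
elim: k => [|k IHk]; first by rewrite !mul1r.
by rewrite exprS mderivM IHk [k.+2%:R]mulrS !exprS; ring.
Qed.

Section LinearForms.

Variable K : numFieldType.
Implicit Types (p F G L M : {mpoly K[2]}) (P : 'I_2 -> K).

Definition linform (a b : K) : {mpoly K[2]} := a *: 'X_x0 + b *: 'X_x1.

Lemma dhomogXU n (i : 'I_n) : ('X_i : {mpoly K[n]}) \is 1.-homog.
Proof. by rewrite dhomogX /= mdeg1. Qed.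

Lemma dhomog_linform a b : linform a b \is 1.-homog.
Proof. by rewrite rpredD // rpredZ // dhomogXU. Qed.

Lemma mderiv_linform0 a b : (linform a b)^`M(x0) = a%:MP.
Proof.
rewrite mderivD !mderivZ !mderivX !mnm1E /= scale0r scaler0 addr0 scale1r.
by rewrite -[X in (X - _)%MM]add0m addmK mpolyX0 -mul_mpolyC mulr1.
Qed.

Lemma mderiv_linform1 a b : (linform a b)^`M(x1) = b%:MP.
Proof.
rewrite mderivD !mderivZ !mderivX !mnm1E /= scale0r scaler0 add0r scale1r.
by rewrite -[X in (X - _)%MM]add0m addmK mpolyX0 -mul_mpolyC mulr1.
Qed.

Lemma dhomogC n (c : K) : (c%:MP : {mpoly K[n]}) \is 0.-homog.
Proof. by rewrite -alg_mpolyC rpredZ // dhomog1. Qed.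

Lemma dhomog0E n (p : {mpoly K[n]}) : p \is 0.-homog -> exists c, p = c%:MP.
Proof.
move=> hp; exists p@_0; apply/mpolyP => m; rewrite mcoeffC.
have [<-|m0] := eqVneq 0%MM m; first by rewrite mulr1.
by rewrite mulr0 (dhomog_nemf_coeff hp) //= mdeg_eq0 eq_sym.
Qed.

Lemma dhomog1E L : L \is 1.-homog -> exists a b, L = linform a b.
Proof.
move=> hL; have [a La] := dhomog0E (dhomog_mderiv x0 hL).
have [b Lb] := dhomog0E (dhomog_mderiv x1 hL).
exists a, b; rewrite -[L]scale1r -(euler hL) big_x0x1 La Lb.
by rewrite mulrC mul_mpolyC mulrC mul_mpolyC.
Qed.

Definition nonzero_pt P := exists i, P i != 0.

Definition root_form P : {mpoly K[2]} := linform (P x1) (- P x0).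

Lemma meval_linform P a b : (linform a b).@[P] = a * P x0 + b * P x1.
Proof. by rewrite mevalD !mevalZ !mevalXU. Qed.

Lemma meval_root_form P : (root_form P).@[P] = 0.
Proof. by rewrite meval_linform; ring. Qed.

(* Modulo the form L vanishing at P one has P_i X_j = P_j X_i, so that
   P_i^d G = G(P) X_i^d modulo L for every form G of degree d. *)
Lemma dhomog_mod_root_form d i P G : G \is d.+1.-homog ->
  exists2 H, H \is d.-homog &
    P i ^+ d.+1 *: G - G.@[P] *: 'X_i ^+ d.+1 = root_form P * H.
Proof.
have swapX j : exists c, P i *: 'X_j - P j *: 'X_i = root_form P * c%:MP.
  case: (ord2_cases i) (ord2_cases j) => -> [] ->;
    [exists 0|exists (- 1)|exists 1|exists 0];
  by rewrite /root_form /linform [RHS]mulrC mul_mpolyC -?mul_mpolyC ?mpolyCN; ring.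
have hX m : mdeg m = d.+1 -> exists2 H, H \is d.-homog &
    P i ^+ d.+1 *: 'X_[m] - 'X_[m].@[P] *: 'X_i ^+ d.+1 = root_form P * H.
  elim: d m => [|d IHd] m /mdegS_split[j [m' [-> degm']]].
    move: degm' => /eqP; rewrite mdeg_eq0 => /eqP ->; rewrite add0m mevalXU.
    by have [c hc] := swapX j => /=; exists c%:MP; rewrite ?dhomogC ?expr1.
  have [H hH eqH] := IHd m' degm'; have [c hc] := swapX j.
  exists (P i *: ('X_j * H) + (c * 'X_[m'].@[P]) *: 'X_i ^+ d.+1).
    rewrite rpredD // rpredZ //; first exact: (dhomogM (dhomogXU j) hH).
    by have := dhomogMn d.+1 (dhomogXU i); rewrite mul1n.
  rewrite mpolyXD mevalM mevalXU [P i ^+ d.+2]exprS ['X_i ^+ d.+2]exprS.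
  move: hc eqH; rewrite -!mul_mpolyC !mpolyCM.
  move: (root_form P) (P i ^+ d.+1) ('X_i ^+ d.+1) => L A Y hc eqH.
  (* Telescoping: replace ['X_[m']] first, then ['X_j]. *)
  transitivity ((P i)%:MP * 'X_j * (A%:MP * 'X_[m'] - 'X_[m'].@[P]%:MP * Y)
    + 'X_[m'].@[P]%:MP * Y * ((P i)%:MP * 'X_j - (P j)%:MP * 'X_i)); first by ring.
  by rewrite hc eqH; ring.
move=> /dhomogP hG; rewrite [G]mpolyE scaler_sumr raddf_sum /= scaler_suml -sumrB.
have : all (fun m => mdeg m == d.+1) (msupp G) by apply/allP => m /hG/eqP.
elim: (msupp G) => [|m s IHs] /=.
  by exists 0; rewrite ?rpred0 // big_nil mulr0.
move=> /andP[/eqP/hX[H hH eqH] /IHs[H' hH' eqH']].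
exists (G@_m *: H + H'); first by rewrite rpredD // rpredZ.
rewrite big_cons eqH' mevalZ mulrDr -scalerAr -eqH scalerBr !scalerA.
by rewrite [P i ^+ _ * _]mulrC.
Qed.

(** At a zero P of G the preceding congruence loses its second term, and a nonzero coordinate of P
    can be divided out. *)
Lemma dhomog_factor d P G : nonzero_pt P -> G \is d.+1.-homog -> G.@[P] = 0 ->
  exists2 H, H \is d.-homog & G = root_form P * H.
Proof.
move=> [i Pi0] hG G0; have [H hH] := dhomog_mod_root_form i P hG.
rewrite G0 scale0r subr0 => eqH; exists ((P i ^+ d.+1)^-1 *: H).
  by rewrite rpredZ.
by rewrite -scalerAr -eqH scalerK // expf_neq0.
Qed.

Lemma root_form_neq0 P : nonzero_pt P -> root_form P != 0.
Proof.
move=> [i Pi0]; apply/eqP => eP.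
have := mderiv_linform0 (P x1) (- P x0); have := mderiv_linform1 (P x1) (- P x0).
rewrite -/(root_form P) eP !mderiv0 => /esym/eqP + /esym/eqP.
rewrite !mpolyC_eq0 oppr_eq0 => /eqP p0 /eqP p1.
by case: (ord2_cases i) Pi0 => ->; rewrite ?p0 ?p1 eqxx.
Qed.

Lemma dhomog_multiplicity d P F : nonzero_pt P -> F \is d.-homog -> F != 0 ->
  exists m G, F = root_form P ^+ m * G /\ G.@[P] != 0.
Proof.
move=> P0; elim: d F => [|d IHd] F hF F0.
  exists 0%N, F; rewrite mul1r; split=> //.
  by move: F0; have [c ->] := dhomog0E hF; rewrite mevalC mpolyC_eq0.
have [FP0|FP] := eqVneq F.@[P] 0; last by exists 0%N, F; rewrite mul1r.
have [H hH eF] := dhomog_factor P0 hF FP0.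
have H0 : H != 0 by apply: contraNneq F0 => H0; rewrite eF H0 mulr0.
have [m [G [eH GP]]] := IHd H hH H0.
by exists m.+1, G; rewrite exprS -mulrA -eH.
Qed.

(** Write F = L^(m+1) G with L the form of the root P and G(P) nonzero. Dividing the relation by L^m
    and evaluating at P leaves (m+1) (P_1 l0 - P_0 l1)(P) G(P) = 0, and m + 1 is invertible. *)
Lemma root_of_annihilated d P F (l0 l1 : {mpoly K[2]}) :
  nonzero_pt P -> F \is d.-homog -> F != 0 ->
  l0 * F^`M(x0) + l1 * F^`M(x1) = 0 -> F.@[P] = 0 ->
  ('X_x0 * l1 - 'X_x1 * l0).@[P] = 0.
Proof.
move=> P0 hF F0 rel FP0; have [[|m] [G [eF GP]]] := dhomog_multiplicity P0 hF F0.
  by move: GP; rewrite -[G]mul1r -[1]/(root_form P ^+ 0) -eF FP0 eqxx.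
move: rel; rewrite eF !mderivM !mderivXn mderiv_linform0 mderiv_linform1.
move: (root_form P) (meval_root_form P) (root_form_neq0 P0) => L LP L0.
move=> rel; have : L ^+ m * (m.+1%:R * ((P x1)%:MP * l0 - (P x0)%:MP * l1) * G
    + L * (l0 * G^`M(x0) + l1 * G^`M(x1))) = 0.
  by rewrite -[RHS]rel exprS mpolyCN; ring.
move/eqP; rewrite mulf_eq0 expf_eq0 (negPf L0) andbF => /eqP/(congr1 (meval P)).
rewrite meval0 mevalD [X in _ + X]mevalM LP mul0r addr0 !mevalM => /eqP.
rewrite mulf_eq0 (negPf GP) orbF mulf_eq0 -mpolyC_nat mevalC pnatr_eq0 /=.
rewrite !mevalB !mevalM !mevalC !mevalXU => /eqP e.
by rewrite -[LHS]opprK opprB e oppr0.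
Qed.

(** If the quadratic form vanished, combining it with the relation and Euler's formula would give l0
    F = l1 F = 0. *)
Lemma annihilated_neq0 d F (l0 l1 : {mpoly K[2]}) : F \is d.+1.-homog -> F != 0 ->
  (l0 != 0) || (l1 != 0) -> l0 * F^`M(x0) + l1 * F^`M(x1) = 0 ->
  'X_x0 * l1 - 'X_x1 * l0 != 0.
Proof.
move=> hF F0 + rel; rewrite -negb_and; apply: contraNneq => q0.
have d0 : d.+1%:R != 0 :> K by rewrite pnatr_eq0.
have := euler hF; rewrite big_x0x1 /= => eul.
have cancel (l : {mpoly K[2]}) : l * (d.+1%:R *: F) = 0 -> l == 0.
  by move/eqP; rewrite mulf_eq0 scaler_eq0 (negPf d0) (negPf F0) !orbF.
have q_rel a b :
    a * ('X_x0 * l1 - 'X_x1 * l0) + b * (l0 * F^`M(x0) + l1 * F^`M(x1)) = 0.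
  by rewrite q0 rel !mulr0 addr0.
apply/andP; split; apply: cancel; rewrite -eul.
- by rewrite -[RHS](q_rel (- F^`M(x1)) 'X_x0); ring.
- by rewrite -[RHS](q_rel F^`M(x0) 'X_x1); ring.
Qed.

End LinearForms.

(** * Splitting forms over an algebraically closed field *)

Section ClosedField.

Variable K : numClosedFieldType.
Implicit Types (p F G L M : {mpoly K[2]}) (P : 'I_2 -> K).

(** Dehomogenise to f(t) = F(1, t). A root t of f gives the zero (1, t). If f is a nonzero constant,
    its coefficient of degree d + 1, which is F(0, 1), vanishes. *)
Lemma dhomog_root d F : F \is d.+1.-homog -> exists2 P, nonzero_pt P & F.@[P] = 0.
Proof.
move=> /dhomogP hF.
pose f : {poly K} := \sum_(m <- msupp F) F@_m *: 'X^(m x1).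
pose pt (a b : K) (i : 'I_2) := if i == x0 then a else b.
have evF a b : F.@[pt a b] = \sum_(m <- msupp F) F@_m * (a ^+ m x0 * b ^+ m x1).
  by rewrite mevalE; apply: eq_bigr => m _; rewrite big_x0x1.
have [/size_poly1P[c c0 fc]|/closed_rootP[t ft]] := boolP (size f == 1).
  exists (pt 0 1); first by exists x1; rewrite oner_neq0.
  transitivity (f`_d.+1); last by rewrite fc coefC.
  rewrite evF coef_sum; apply: eq_big_seq => m mF.
  rewrite coefZ coefXn expr1n mulr1 expr0n; congr (_ * _%:R).
  by have := hF m mF; rewrite /= mdegE big_x0x1 /=; lia.
exists (pt 1 t); first by exists x0; rewrite oner_neq0.
rewrite evF; move: ft; rewrite /root /f horner_sum => /eqP ft; rewrite -[RHS]ft.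
by apply: eq_bigr => m _; rewrite expr1n mul1r hornerZ hornerXn.
Qed.

Lemma dhomog2_split Q : Q \is 2.-homog ->
  exists M1 M2, [/\ M1 \is 1.-homog, M2 \is 1.-homog & Q = M1 * M2].
Proof.
move=> hQ; have [P P0 QP] := dhomog_root hQ.
have [H hH ->] := dhomog_factor P0 hQ QP.
by exists (root_form P), H; rewrite dhomog_linform.
Qed.

Lemma dhomog1_root M P : nonzero_pt P -> M \is 1.-homog -> M.@[P] = 0 ->
  exists c, M = c *: root_form P.
Proof.
move=> P0 hM MP; have [H hH ->] := dhomog_factor P0 hM MP.
by have [c ->] := dhomog0E hH; exists c; rewrite mulrC mul_mpolyC.
Qed.

(** Induction on the degree: each root of F is a root of [M1] or [M2], so the linear factor split
    off there is proportional to one of them. *)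
Lemma product_of_powers d F M1 M2 : F \is d.-homog -> F != 0 ->
  M1 \is 1.-homog -> M2 \is 1.-homog -> M1 * M2 != 0 ->
  (forall P, nonzero_pt P -> F.@[P] = 0 -> (M1 * M2).@[P] = 0) ->
  exists c a b, (a + b = d)%N /\ F = c *: (M1 ^+ a * M2 ^+ b).
Proof.
move=> + + hM1 hM2; rewrite mulf_eq0 negb_or => + + /andP[M10 M20].
elim: d F => [|d IHd] F hF F0 rootF.
  have [c eF] := dhomog0E hF; exists c, 0%N, 0%N; split=> //.
  by rewrite !expr0 mulr1 alg_mpolyC.
have [P P0 FP] := dhomog_root hF; have [H hH eF] := dhomog_factor P0 hF FP.
have H0 : H != 0 by apply: contraNneq F0 => H0; rewrite eF H0 mulr0.
have [P' P'0 HP'|c [a [b [abd eH]]]] := IHd H hH H0.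
  by apply: rootF; rewrite // eF mevalM HP' mulr0.
have rootE M : M \is 1.-homog -> M != 0 -> M.@[P] = 0 ->
  exists e, root_form P = e *: M.
  move=> hM M0 /(dhomog1_root P0 hM)[e eM]; exists e^-1; rewrite eM scalerK //.
  by apply: contraNneq M0 => e0; rewrite eM e0 scale0r.
move: (rootF P P0 FP); rewrite mevalM => /eqP; rewrite mulf_eq0 eF eH.
case/orP=> /eqP; [move=> /(rootE _ hM1 M10)[e ->] | move=> /(rootE _ hM2 M20)[e ->]].
- exists (e * c), a.+1, b; rewrite addSn abd; split=> //.
  by rewrite exprS -!mul_mpolyC mpolyCM; ring.
- exists (e * c), a, b.+1; rewrite addnS abd; split=> //.
  by rewrite exprS -!mul_mpolyC mpolyCM; ring.
Qed.

(** A root of c goes into a factor with positive exponent; if a = 0, then b = d > 0. *)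
Lemma absorb_scalar d F c M1 M2 a b : (0 < d)%N -> (a + b = d)%N ->
  M1 \is 1.-homog -> M2 \is 1.-homog -> F = c *: (M1 ^+ a * M2 ^+ b) ->
  exists L1 L2, [/\ L1 \is 1.-homog, L2 \is 1.-homog & F = L1 ^+ a * L2 ^+ b].
Proof.
move=> d0 abd hM1 hM2 ->; case: a abd => [/= bd|a abd].
  exists M1, (b.-root c *: M2); rewrite rpredZ //; split=> //.
  by rewrite exprZn rootCK ?expr0 ?mul1r // -[b]add0n bd.
exists (a.+1.-root c *: M1), M2; rewrite rpredZ //; split=> //.
by rewrite exprZn rootCK -?scalerAl.
Qed.

Lemma two_linear_factors d F Q : (0 < d)%N -> F \is d.-homog -> F != 0 ->
  Q \is 2.-homog -> Q != 0 ->
  (forall P, nonzero_pt P -> F.@[P] = 0 -> Q.@[P] = 0) ->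
  exists L1 L2 a b, [/\ L1 \is 1.-homog, L2 \is 1.-homog, (a + b = d)%N &
    F = L1 ^+ a * L2 ^+ b].
Proof.
move=> d0 hF F0 /dhomog2_split[M1 [M2 [hM1 hM2 ->]]] M0 rootF.
have [c [a [b [abd eF]]]] := product_of_powers hF F0 hM1 hM2 M0 rootF.
have [L1 [L2 [hL1 hL2 eL]]] := absorb_scalar d0 abd hM1 hM2 eF.
by exists L1, L2, a, b.
Qed.

Lemma two_linear_factors_of_annihilated d F (l0 l1 : {mpoly K[2]}) :
  (0 < d)%N -> F \is d.-homog -> F != 0 ->
  l0 \is 1.-homog -> l1 \is 1.-homog -> (l0 != 0) || (l1 != 0) ->
  l0 * F^`M(x0) + l1 * F^`M(x1) = 0 ->
  exists L1 L2 a b, [/\ L1 \is 1.-homog, L2 \is 1.-homog, (a + b = d)%N &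
    F = L1 ^+ a * L2 ^+ b].
Proof.
move=> d0 hF F0 hl0 hl1 l0l1 rel.
have rootF P : nonzero_pt P -> F.@[P] = 0 -> ('X_x0 * l1 - 'X_x1 * l0).@[P] = 0.
  by move=> P0; apply: (root_of_annihilated P0 hF F0 rel).
apply: (two_linear_factors d0 hF F0 _ _ rootF).
  have := rpredB (dhomogM (dhomogXU K x0) hl1) (dhomogM (dhomogXU K x1) hl0).
  exact.
by apply: (@annihilated_neq0 K d.-1 F); rewrite ?prednK.
Qed.

End ClosedField.

(** * The covariant D(F) *)

Section Dcov.

Variable K : numFieldType.
Implicit Types (p F G : {mpoly K[2]}).

Lemma dpart_mderivm (m : 'X_{1..2}) p : p^`M[m] = dpart (m x0) (m x1) p.
Proof.
rewrite /dpart -mderivmDm; congr (_^`M[_]); apply/mnmP => i.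
by rewrite mnmDE !mulmnE !mnm1E; case: (ord2_cases i) => ->;
  rewrite ?eqxx -?[x0 == x1]/false -?[x1 == x0]/false; lia.
Qed.

Lemma linform_eq0 (a b : K) : (linform a b == 0) = (a == 0) && (b == 0).
Proof.
apply/eqP/andP => [e|[/eqP -> /eqP ->]]; last by rewrite /linform !scale0r addr0.
have := mderiv_linform0 a b; have := mderiv_linform1 a b; rewrite e !mderiv0.
by do 2![move/esym/eqP; rewrite mpolyC_eq0 => ->].
Qed.

Lemma linform_mulE (a b : K) G :
  linform a b * G = a *: ('X_x0 * G) + b *: ('X_x1 * G).
Proof. by rewrite mulrDl -!scalerAl. Qed.

(** A singular matrix has a nonzero left kernel row, here a relation of order 3 among four forms of
    degree d. Four is the largest support allowed in order 3, and d >= 3 keeps the order within the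
    degree. *)
Lemma Dcov_eq0_annihilated d F : (3 <= d)%N -> F \is d.-homog -> Dcov F = 0 ->
  exists l0 l1 : {mpoly K[2]}, [/\ l0 \is 1.-homog, l1 \is 1.-homog,
    (l0 != 0) || (l1 != 0) & l0 * F^`M(x0) + l1 * F^`M(x1) = 0].
Proof.
move=> d3 hF /eqP/det0P[v v0].
set rows := [tuple _; _; _; _] => vA.
have hrow i j : 'X_i * F^`M(j) \is d.-homog.
  have := dhomogM (dhomogXU K i) (dhomog_mderiv j hF).
  by rewrite add1n prednK ?(ltn_trans _ d3).
have hrows i : tnth rows i \is d.-homog.
  by rewrite (tnth_nth 0); case: i => -[|[|[|[|//]]]] ? /=.
have [||m degm|c [i ci] csum] :=
  linear_dependence_of_wronskian hrows (v := v ord0) d3.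
- by rewrite (leq_trans (max_card _)) // card_ord.
- by move: v0 => /rV0Pn.
- have m1 : (m x1 < 4)%N by move: degm; rewrite mdegE big_x0x1 /=; lia.
  have := congr1 (fun w : 'rV_4 => w ord0 (Ordinal m1)) vA.
  rewrite !mxE /= => vA0; rewrite -[RHS]vA0.
  apply: eq_bigr => i _; rewrite mxE dpart_mderivm; congr (_ * dpart _ _ _).
  by move: degm; rewrite mdegE big_x0x1 /=; lia.
(* The rows are ordered x0 F_x0, x0 F_x1, x1 F_x0, x1 F_x1: entries 0 and 2 multiply F_x0, entries 1
   and 3 multiply F_x1. *)
exists (linform (c (inord 0)) (c (inord 2))), (linform (c (inord 1)) (c (inord 3))).
rewrite !dhomog_linform; split=> //.
  rewrite !linform_eq0; apply: contraNT ci; rewrite negb_or !negbK.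
  move=> /andP[/andP[c0 c2] /andP[c1 c3]].
  by case: i => -[|[|[|[|//]]]] i4; rewrite -[Ordinal i4]inord_val.
move: csum; rewrite !big_ord_recl big_ord0 !(tnth_nth 0) /= => csum.
rewrite !linform_mulE -[RHS]csum.
have E (l : 'I_4) : c l = c (inord l) by rewrite inord_val.
rewrite (E ord0) (E (lift ord0 ord0)) (E (lift ord0 (lift ord0 ord0))).
rewrite (E (lift ord0 (lift ord0 (lift ord0 ord0)))) /=.
rewrite -!mul_mpolyC; ring.
Qed.

(** Here [c i j] is the coefficient of x_i F_(x_j). Applying the order-3 partials to the relation
    shows that these constants form a left kernel row. *)
Lemma annihilated_Dcov_eq0 F (c : 'I_2 -> 'I_2 -> K) :
  (exists i j, c i j != 0) ->
  linform (c x0 x0) (c x1 x0) * F^`M(x0)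
    + linform (c x0 x1) (c x1 x1) * F^`M(x1) = 0 ->
  Dcov F = 0.
Proof.
move=> [i [j cij]]; rewrite !linform_mulE => rel; apply/eqP/det0P.
pose w := [tuple c x0 x0; c x0 x1; c x1 x0; c x1 x1].
exists (\row_k (tnth w k)%:MP).
  apply/rV0Pn; pose k : 'I_4 := inord (2 * i + j); exists k.
  rewrite mxE mpolyC_eq0 (tnth_nth 0) inordK; last first.
    by case: (ord2_cases i) => ->; case: (ord2_cases j) => ->.
  by move: cij; case: (ord2_cases i) => ->; case: (ord2_cases j) => ->.
apply/rowP => k; rewrite !mxE.
have dpartD mu nu p q :
    dpart mu nu (p + q) = dpart mu nu p + dpart mu nu q :> {mpoly K[2]}.
  by rewrite /dpart !mderivmD.
have dpartZ mu nu a p : dpart mu nu (a *: p) = a *: dpart mu nu p :> {mpoly K[2]}.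
  by rewrite /dpart !mderivmZ.
have := congr1 (dpart (3 - k) k) rel; rewrite !dpartD !dpartZ.
rewrite [RHS](_ : _ = 0); last by rewrite /dpart !linear0.
move=> relk; rewrite -[RHS]relk.
under eq_bigr do rewrite !mxE mul_mpolyC !(tnth_nth 0).
rewrite !big_ord_recl big_ord0 addr0 /= -!mul_mpolyC.
by ring.
Qed.

End Dcov.

(** * Products of powers of two linear forms *)

Section LogarithmicDerivative.

Variables (K : numFieldType) (u v : 'I_2 -> K).
Implicit Types (A B F P Q : {mpoly K[2]}) (a b c d : K).

Let x : {mpoly K[2]} := linform (u x0) (u x1).
Let y : {mpoly K[2]} := linform (v x0) (v x1).
Let Delta : K := u x0 * v x1 - u x1 * v x0.

Let dx i : x^`M(i) = (u i)%:MP.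
Proof. by case: (ord2_cases i) => ->; rewrite ?mderiv_linform0 ?mderiv_linform1. Qed.

Let dy i : y^`M(i) = (v i)%:MP.
Proof. by case: (ord2_cases i) => ->; rewrite ?mderiv_linform0 ?mderiv_linform1. Qed.

(* dP/P = a dx/x + b dy/y, with denominators cleared: P behaves like the
   monomial x^a y^b, but no truncated exponent a - 1 appears. *)
Definition logder a b P := forall i,
  x * y * P^`M(i) = ((a * u i)%:MP * y + (b * v i)%:MP * x) * P.

Lemma logderM a b c d P Q :
  logder a b P -> logder c d Q -> logder (a + c) (b + d) (P * Q).
Proof.
move=> hP hQ i; rewrite mderivM.
transitivity ((x * y * P^`M(i)) * Q + P * (x * y * Q^`M(i))); first by ring.
by rewrite hP hQ; ring.
Qed.

Lemma logderX a b P k : logder a b P -> logder (k%:R * a) (k%:R * b) (P ^+ k).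
Proof.
move=> hP; elim: k => [|k IHk].
  by move=> i; rewrite expr0 -mpolyC1 mderivC; ring.
by rewrite exprS [k.+1%:R]mulrS !mulrDl !mul1r; apply: logderM.
Qed.

Lemma logderZ a b c P : logder a b P -> logder a b (c *: P).
Proof. by move=> hP i; rewrite mderivZ -scalerAr hP -scalerAr. Qed.

Lemma logder_monomial m n : logder m%:R n%:R (x ^+ m * y ^+ n).
Proof.
have hx : logder 1 0 x by move=> i; rewrite dx; ring.
have hy : logder 0 1 y by move=> i; rewrite dy; ring.
have := logderM (logderX m hx) (logderX n hy).
by rewrite !mulr0 !mulr1 addr0 add0r.
Qed.

(** Differentiate the first-order identity, multiply by x y once more and eliminate the first
    derivatives; the outcome is formally that for x^a y^b. *)
Lemma logder2 a b P i j : logder a b P ->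
  (x * y) ^+ 2 * P^`M(i)^`M(j) =
  ((a * (a - 1) * u i * u j)%:MP * y ^+ 2
   + (a * b * (u i * v j + u j * v i))%:MP * (x * y)
   + (b * (b - 1) * v i * v j)%:MP * x ^+ 2) * P.
Proof.
move=> hP; have := congr1 (mderiv j) (hP i).
rewrite !(mderivM, mderivD, mderivC, dx, dy) => e.
transitivity (x * y * (((u j)%:MP * y + x * (v j)%:MP) * P^`M(i)
    + x * y * P^`M(i)^`M(j))
    - ((u j)%:MP * y + x * (v j)%:MP) * (x * y * P^`M(i))); first by ring.
rewrite e mulrDr [_ * (_ * P^`M(j))]mulrCA !hP; ring.
Qed.

(** The second transvectant without its normalising scalar: Cayley's Omega process applied twice. *)
Definition bracket A B : {mpoly K[2]} :=
  dpart 2 0 A * dpart 0 2 B - 2%:R * dpart 1 1 A * dpart 1 1 B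
  + dpart 0 2 A * dpart 2 0 B.

Lemma dpart20 A : dpart 2 0 A = A^`M(x0)^`M(x0).
Proof. by rewrite /dpart !mderivSn !mderivn0. Qed.

Lemma dpart11 A : dpart 1 1 A = A^`M(x0)^`M(x1).
Proof. by rewrite /dpart !mderivSn !mderivn0. Qed.

Lemma dpart02 A : dpart 0 2 A = A^`M(x1)^`M(x1).
Proof. by rewrite /dpart !mderivSn !mderivn0. Qed.

Lemma bracket_hessian A : bracket A A = 2%:R * hessian A.
Proof. by rewrite /bracket /hessian; ring. Qed.

Lemma transvectant2E m n A B : (2 <= m)%N -> (2 <= n)%N ->
  transvectant m n 2 A B =
  (m%:R * (m%:R - 1) * n%:R * (n%:R - 1))^-1 *: bracket A B.
Proof.
move=> m2 n2; rewrite /transvectant leq_min m2 n2 /=; congr (_ *: _).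
  case: m n m2 n2 => [|[|m]] // [|[|n]] // _ _.
  rewrite !subSS !subn0 !factS !natrM -![_.+2%:R]natr1 -![_.+1%:R]natr1.
  have fact0 k : k`!%:R != 0 :> K by rewrite pnatr_eq0 -lt0n fact_gt0.
  have nz k : k%:R + 1 != 0 :> K by rewrite natr1 pnatr_eq0.
  have nz' k : k%:R + 1 + 1 != 0 :> K by rewrite !natr1 pnatr_eq0.
  by rewrite ?addrK; field; rewrite !nz !nz' !fact0.
rewrite !big_ord_recr big_ord0 /= /bracket !subn0 !subnn subSS subn0.
by rewrite bin0 binn bin1; ring.
Qed.

Hypothesis xy0 : x * y != 0.

(** The bracket of x^a y^b and x^c y^d in the coordinates x, y, with [Delta ^+ 2] from the change of
    variables. The identity also holds for [Delta] zero, since it is checked on second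
    derivatives. *)
Lemma bracket_logder a b c d A B : logder a b A -> logder c d B ->
  (x * y) ^+ 2 * bracket A B =
  (Delta ^+ 2 * (a * (a - 1) * d * (d - 1) - 2%:R * a * b * c * d
                 + b * (b - 1) * c * (c - 1)))%:MP * (A * B).
Proof.
move=> hA hB; apply: (mulfI (expf_neq0 2 xy0)); rewrite /bracket.
transitivity (((x * y) ^+ 2 * dpart 2 0 A) * ((x * y) ^+ 2 * dpart 0 2 B)
  - 2%:R * ((x * y) ^+ 2 * dpart 1 1 A) * ((x * y) ^+ 2 * dpart 1 1 B)
  + ((x * y) ^+ 2 * dpart 0 2 A) * ((x * y) ^+ 2 * dpart 2 0 B)); first by ring.
rewrite !(dpart20, dpart11, dpart02) !(logder2 _ _ hA) !(logder2 _ _ hB).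
rewrite /Delta; ring.
Qed.

Lemma Jcov_logder a b c d p q P Q : (2 <= p)%N -> (2 <= q)%N ->
  a + b = p%:R -> c + d = q%:R -> logder a b P -> logder c d Q ->
  (x * y) ^+ 2 * Jcov p q P Q =
  (- (p%:R - q%:R - 1) * (a - c) * (b - d) * Delta ^+ 2)%:MP * (P * Q) ^+ 2.
Proof.
move=> p2 q2 abp cdq hP hQ; rewrite /Jcov !transvectant2E //; [|lia..].
have hP2 := logderX 2 hP; have hQ2 := logderX 2 hQ.
rewrite -!scalerAr !scalerA -!mul_mpolyC.
set k1 := z1 K p q * _; set k2 := z2 K p q * _; set k3 := z3 K p q * _.
transitivity (k1%:MP * Q ^+ 2 * ((x * y) ^+ 2 * bracket P P)
  + k2%:MP * P ^+ 2 * ((x * y) ^+ 2 * bracket Q Q)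
  + k3%:MP * ((x * y) ^+ 2 * bracket (P ^+ 2) (Q ^+ 2))); first by ring.
rewrite (bracket_logder hP hP) (bracket_logder hQ hQ) (bracket_logder hP2 hQ2).
set e1 := Delta ^+ 2 * _; set e2 := Delta ^+ 2 * _; set e3 := Delta ^+ 2 * _.
transitivity ((k1 * e1 + k2 * e2 + k3 * e3)%:MP * (P * Q) ^+ 2); first by ring.
congr (_%:MP * _); rewrite /k1 /k2 /k3 /e1 /e2 /e3 /z1 /z2 /z3 !natrM.
have nz (m k : nat) : m != k -> m%:R - k%:R != 0 :> K by rewrite subr_eq0 eqr_nat.
have p0 : p%:R != 0 :> K by rewrite pnatr_eq0; lia.
have q0 : q%:R != 0 :> K by rewrite pnatr_eq0; lia.
have p1 : p%:R - 1 != 0 :> K by apply: (nz p 1%N); lia.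
have q1 : q%:R - 1 != 0 :> K by apply: (nz q 1%N); lia.
have pp1 : 2 * p%:R - 1 != 0 :> K by rewrite -natrM; apply: (nz _ 1%N); lia.
have qq1 : 2 * q%:R - 1 != 0 :> K by rewrite -natrM; apply: (nz _ 1%N); lia.
(* Eliminating p = a + b and q = c + d leaves an identity of rational functions in a, b, c, d, whose
   denominators are the quantities just shown nonzero. *)
move: p0 q0 p1 q1 pp1 qq1; rewrite -abp -cdq => p0 q0 p1 q1 pp1 qq1.
by field; rewrite p0 q0 p1 q1 pp1 qq1.
Qed.

End LogarithmicDerivative.

(** * The Hessian and both covariants on a product of two powers *)

Section Monomial.

Variables (K : numFieldType) (u v : 'I_2 -> K).

Let x : {mpoly K[2]} := linform (u x0) (u x1).
Let y : {mpoly K[2]} := linform (v x0) (v x1).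
Let Delta : K := u x0 * v x1 - u x1 * v x0.

Hypothesis xy0 : x * y != 0.

(** With m = a + 1 and n = b + 1, this is m(m-1)n(n-1) - (mn)^2 = -mn(m+n-1). *)
Lemma hessian_monomial a b :
  hessian (x ^+ a.+1 * y ^+ b.+1) =
  (- (Delta ^+ 2 * a.+1%:R * b.+1%:R * (a + b).+1%:R)) *: (x ^+ a * y ^+ b) ^+ 2.
Proof.
have nz2 : 2%:R != 0 :> {mpoly K[2]} by rewrite -mpolyC_nat mpolyC_eq0 pnatr_eq0.
apply: (mulfI nz2); rewrite -bracket_hessian; apply: (mulfI (expf_neq0 2 xy0)).
have hF := logder_monomial u v a.+1 b.+1.
rewrite (bracket_logder xy0 hF hF) -mul_mpolyC -[(a + b).+1]addn1 !natrD -!natr1 !exprS.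
by rewrite -/x -/y -/Delta; ring.
Qed.

(** The scalar in the Hessian does not affect its logarithmic derivative. Since d > 2 and 2e <= d,
    both formal degrees are at least 2, as the formula for [Jcov] requires. *)
Lemma Ccov_monomial a b d e F : F = x ^+ a.+1 * y ^+ b.+1 ->
  (a.+1 + b.+1 = d)%N -> (2 < d)%N -> (0 < e)%N -> (2 * e <= d)%N ->
  (x * y) ^+ 2 * Ccov d e F =
  (- (2 * d%:R - 4 * e%:R - 1)
     * (4 * (d%:R - e%:R - a.+1%:R) * (d%:R - e%:R - b.+1%:R))
     * Delta ^+ 2)%:MP
  * (F ^+ (2 * d - 2 * e - 2) * hessian F ^+ (d - e)) ^+ 2.
Proof.
move=> FE abd d2 e0 ed.
have := logder_monomial u v a.+1 b.+1; rewrite -FE.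
move=> /(logderX (2 * d - 2 * e - 2)) hF.
have hH : logder u v (2%:R * a%:R) (2%:R * b%:R) (hessian F).
  by rewrite FE hessian_monomial; apply/logderZ/logderX/logder_monomial.
have {hH}hH := logderX (d - e) hH.
have pE : (d * (2 * d - 2 * e - 2))%:R = 2 * d%:R * (d%:R - e%:R - 1) :> K.
  rewrite natrM !natrB ?natrM; [ring|lia..].
have qE : ((2 * d - 4) * (d - e))%:R = 2 * (d%:R - 2) * (d%:R - e%:R) :> K.
  rewrite natrM !natrB ?natrM; [ring|lia..].
have dE : d%:R = a%:R + b%:R + 2 :> K by rewrite -abd natrD -!natr1; ring.
have mE : (2 * d - 2 * e - 2)%:R = 2 * (d%:R - e%:R - 1) :> K.
  rewrite !natrB ?natrM; [ring|lia..].
have deE : (d - e)%:R = d%:R - e%:R :> K by rewrite natrB //; lia.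
rewrite /Ccov (Jcov_logder xy0 _ _ _ _ hF hH); first last.
- by rewrite qE deE dE; ring.
- by rewrite pE mE -!natr1 dE; ring.
- by nia.
- by nia.
congr (_%:MP * _); rewrite -/Delta pE qE mE deE -!natr1 dE; ring.
Qed.

Lemma Dcov_monomial a b : Dcov (x ^+ a * y ^+ b) = 0.
Proof.
have hF := logder_monomial u v a b; set F := _ * _ in hF *.
(* The derivation -F_x1 d/dx0 + F_x0 d/dx1 kills F; multiplied by x y / F it has linear
   coefficients, recorded in c. *)
pose c i j := if j == x0 then - (a%:R * u x1 * v i + b%:R * v x1 * u i)
              else a%:R * u x0 * v i + b%:R * v x0 * u i.
have c0E :
    linform (c x0 x0) (c x1 x0) = - ((a%:R * u x1)%:MP * y + (b%:R * v x1)%:MP * x).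
  by rewrite /c /= /x /y /linform -!mul_mpolyC; ring.
have c1E : linform (c x0 x1) (c x1 x1) = (a%:R * u x0)%:MP * y + (b%:R * v x0)%:MP * x.
  by rewrite /c /= /x /y /linform -!mul_mpolyC; ring.
have [/existsP[[i j] /= cij]|/existsPn c0] :=
  boolP [exists ij : 'I_2 * 'I_2, c ij.1 ij.2 != 0].
  apply: (@annihilated_Dcov_eq0 _ _ c); first by exists i, j.
  apply: (mulfI xy0); rewrite mulr0 mulrDr !(mulrCA (x * y)) !hF -/x -/y c0E c1E.
  by ring.
have {}c0 i j : c i j = 0 by apply/eqP; have := c0 (i, j); rewrite negbK.
move: c0E c1E; rewrite !c0 /linform !scale0r addr0 => /esym/eqP.
rewrite oppr_eq0 => /eqP c0E /esym c1E.
(* If all these coefficients vanish, so do both partials of F, and x0 d/dx0 serves as the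
   derivation. *)
apply: (@annihilated_Dcov_eq0 _ _ (fun i j => ((i == x0) && (j == x0))%:R)).
  by exists x0, x0; rewrite /= oner_neq0.
apply: (mulfI xy0); rewrite mulr0 mulrDr !(mulrCA (x * y)) !hF -/x -/y c0E c1E.
by ring.
Qed.

End Monomial.

(** * The two implications *)

Section Main.

Variable K : numClosedFieldType.
Implicit Types (F L M : {mpoly K[2]}).

Lemma dhomog1_fun L : L \is 1.-homog ->
  exists u : 'I_2 -> K, L = linform (u x0) (u x1).
Proof.
by move=> /dhomog1E[a [b ->]]; exists (fun i => if i == x0 then a else b).
Qed.

Lemma two_linear_factors_of_Dcov d F : (2 <= d)%N -> F \is d.-homog -> F != 0 ->
  Dcov F = 0 ->
  exists L1 L2 a b, [/\ L1 \is 1.-homog, L2 \is 1.-homog, (a + b = d)%N &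
    F = L1 ^+ a * L2 ^+ b].
Proof.
move=> d2 hF F0 D0; have [d3|d3] := ltnP 2 d.
  have [l0 [l1 [hl0 hl1 l01 rel]]] := Dcov_eq0_annihilated d3 hF D0.
  by apply: two_linear_factors_of_annihilated rel => //; lia.
have d2E : d = 2%N by lia.
(* In degree 2 the form F is itself a quadratic form through its roots. *)
by rewrite d2E in hF *; apply: (@two_linear_factors _ 2 F F).
Qed.

(** This settles d = 2, e = 1, where both formal degrees are 0. *)
Lemma Jcov00 P Q : Jcov 0 0 P Q = 0 :> {mpoly K[2]}.
Proof.
by rewrite /Jcov /z1 /z2 /z3 expr0n /= !mul0r oppr0 !scale0r !addr0.
Qed.

Theorem power_product_iff_covariants d e F : (1 <= e)%N -> (2 * e <= d)%N ->
  F \is d.-homog -> F != 0 ->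
  (exists L1 L2 : {mpoly K[2]}, [/\ L1 \is 1.-homog, L2 \is 1.-homog &
     F = L1 ^+ (d - e) * L2 ^+ e]) <-> (Ccov d e F = 0 /\ Dcov F = 0).
Proof.
move=> e1 ed hF F0; split=>
  [[L1 [L2 [/dhomog1_fun[u uE] /dhomog1_fun[v vE] FE]]]|[C0 D0]].
  have xy0 : linform (u x0) (u x1) * linform (v x0) (v x1) != 0.
    rewrite -uE -vE; move: F0; rewrite FE !mulf_eq0 !negb_or !expf_eq0.
    by rewrite e1 subn_gt0 (_ : (e < d)%N); last lia.
  rewrite FE uE vE; split; last exact: Dcov_monomial.
  have [d3|d3] := ltnP 2 d; last first.
    by have [-> ->] : d = 2%N /\ e = 1%N by [split; lia]; apply: Jcov00.
  apply: (mulfI (expf_neq0 2 xy0)); rewrite mulr0.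
  (* With first exponent d - e, the factor d - e - a of the formula is zero. *)
  have := @Ccov_monomial K u v xy0 (d - e).-1 e.-1 d e _ erefl.
  rewrite !prednK; [|lia..].
  move=> ->; [|lia..]; rewrite natrB; last by lia.
  by rewrite subrr !(mulr0, mul0r).
have d2 : (2 <= d)%N by lia.
have [L1 [L2 [a [b [hL1 hL2 abd FE]]]]] := two_linear_factors_of_Dcov d2 hF F0 D0.
(* A scalar multiple of a d-th power has the required shape, with both linear forms proportional to
   L. *)
have pow c L : L \is 1.-homog -> F = c *: L ^+ d -> exists L1 L2 : {mpoly K[2]},
   [/\ L1 \is 1.-homog, L2 \is 1.-homog & F = L1 ^+ (d - e) * L2 ^+ e].
  move=> hL FL; apply: (@absorb_scalar _ d F c L L) => //; try lia.
  by rewrite -exprD subnK //; lia.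
have [a0|a0] := posnP a.
  apply: (pow 1 _ hL2); rewrite FE a0 scale1r mul1r; congr (_ ^+ _); lia.
have [b0|b0] := posnP b.
  apply: (pow 1 _ hL1); rewrite FE b0 scale1r mulr1; congr (_ ^+ _); lia.
case: (dhomog1_fun hL1) (dhomog1_fun hL2) => [u uE] [v vE].
have xy0 : linform (u x0) (u x1) * linform (v x0) (v x1) != 0.
  rewrite -uE -vE; move: F0; rewrite FE !mulf_eq0 !negb_or !expf_eq0.
  by rewrite a0 b0.
(* If [Delta] vanishes, [L1] and [L2] are proportional and F is again a multiple of a d-th power. *)
have [Delta0|Delta0] := eqVneq (u x0 * v x1 - u x1 * v x0) 0.
  have [t tE] : exists t, L2 = t *: L1.
    have : u x0 != 0 \/ u x1 != 0.
      move: xy0; rewrite mulf_eq0 negb_or linform_eq0 negb_and => /andP[/orP ? _] //.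
    move/eqP: Delta0; rewrite subr_eq0 => /eqP Delta0; rewrite uE vE /linform.
    case=> ux; [exists (v x0 / u x0)|exists (v x1 / u x1)]; rewrite scalerDr !scalerA
      divfK //; congr (_ *: _ + _ *: _).
    - by rewrite mulrAC [v x0 * _]mulrC -Delta0 mulrC mulKf.
    - by rewrite mulrAC [v x1 * _]mulrC Delta0 mulrC mulKf.
  apply: (pow (t ^+ b) _ hL1).
  by rewrite FE tE exprZn -scalerAr -exprD abd.
have [d3|d3] := ltnP 2 d; last first.
  have [a1 b1] : a = 1%N /\ b = 1%N by split; lia.
  by exists L1, L2; split=> //; rewrite FE; congr (_ ^+ _ * _ ^+ _); lia.
have := @Ccov_monomial K u v xy0 a.-1 b.-1 d e F; rewrite !prednK //.
rewrite -uE -vE C0 mulr0 => /(_ FE abd d3 e1 ed)/esym/eqP.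
have hess0 : hessian F != 0.
  have := @hessian_monomial K u v xy0 a.-1 b.-1.
  rewrite !prednK // -uE -vE -FE => ->.
  rewrite scaler_eq0 negb_or oppr_eq0; apply/andP; split.
    by rewrite !mulf_neq0 ?pnatr_eq0 -?lt0n // expf_neq0.
  move: xy0; rewrite -uE -vE mulf_eq0 negb_or => /andP[L10 L20].
  by rewrite expf_neq0 // mulf_neq0 // expf_neq0.
have FH0 m n : F ^+ m * hessian F ^+ n != 0.
  by rewrite mulf_neq0 // expf_neq0.
rewrite mulf_eq0 mpolyC_eq0 (negPf (expf_neq0 2 (FH0 _ _))).
rewrite orbF mulf_eq0 (negPf (expf_neq0 2 Delta0)) orbF mulf_eq0 oppr_eq0.
(* The factor p - q - 1 is an even number minus 1, hence nonzero; what remains is a = d - e or b = d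
   - e, the latter exchanging [L1] and [L2]. *)
rewrite (_ : 2 * d%:R - 4 * e%:R - 1 = (2 * (d - 2 * e))%:R - 1); last first.
  by rewrite natrM natrB // natrM; ring.
rewrite subr_eq0 (eqr_nat _ _ 1).
rewrite (_ : (2 * (d - 2 * e) == 1)%N = false) /=; last by lia.
rewrite !mulf_eq0 pnatr_eq0 /= -natrB ?subr_eq0 ?eqr_nat; last by lia.
case/orP=> /eqP da.
  by exists L1, L2; split=> //; rewrite FE; congr (_ ^+ _ * _ ^+ _); lia.
by exists L2, L1; split=> //; rewrite FE mulrC; congr (_ ^+ _ * _ ^+ _); lia.
Qed.

End Main.

Theorem theorem8p5 (R : realType) (d e : nat) (F : {mpoly (complex R)[2]}) :
  (1 <= e)%N -> (2 * e <= d)%N ->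
  F \is d.-homog -> F != 0 ->
  ((exists L1 L2 : {mpoly (complex R)[2]},
      [/\ L1 \is 1.-homog, L2 \is 1.-homog &
          F = L1 ^+ (d - e) * L2 ^+ e])
   <-> (Ccov d e F = 0 /\ Dcov F = 0)).
Proof. exact: power_product_iff_covariants. Qed.
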